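(* Let $G$ be a finite group, $\Omega$ a finite set, and $\rho: G\to \operatorname{Sym}(\Omega)$ a permutation representation. Let $A$ be a commutative unital ring of prime characteristic $p$, let $V$ be the right permutation $AG$-module corresponding to $\rho$ (free over $A$ with basis $\Omega$), and let $I\leqslant V$ be the submodule generated by $\omega_0=\sum_{\omega\in\Omega}\omega$. Let $$1\to A \stackrel{\iota}{\to} H\stackrel{\pi}{\to} G\to 1$$ be a central extension, where $A$ is identified with its additive group. If $H$ is a subextension of the semidirect product $G\rightthreetimes V$ with respect to the embedding $I\to V$, then for every $\omega\in \Omega$ the stabilizer $\operatorname{St}(\omega)$ of $\omega$ in $G$ is liftable to $H$.
   Context: Maps and actions are written on the right. The permutation module $V$ is the free $A$-module with basis $\Omega$, with $G$ acting $A$-linearly by permuting the basis elements via $\rho$. $G\rightthreetimes V$ denotes the natural semidirect product: its elements are written uniquely as $gv$ with $g\in G$, $v\in V$, with multiplication $(gv)(hw)=gh\,(v\cdot h+w)$ (additive notation in $V$), and it maps onto $G$ by $gv\mapsto g$ with kernel $V$. The extension $1\to A \stackrel{\iota}{\to} H\stackrel{\pi}{\to} G\to 1$ is central if it is a short exact sequence of groups with $\operatorname{Im}\iota\leqslant \mathrm{Z}(H)$. Stabilizer: $\operatorname{St}(\omega)$ is the set of $g\in G$ such that $\rho(g)$ fixes $\omega$. Liftable: a subgroup $S\leqslant G$ is liftable to $H$ if the full preimage $S\pi^{-1}\leqslant H$ splits over $\operatorname{Im}\iota$, i.e. $\operatorname{Im}\iota$ has a complement in $S\pi^{-1}$. Subextension: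 let $\alpha: A\to I$ be the $AG$-module isomorphism given by $1\mapsto\omega_0$, i.e. $a\mapsto a\omega_0$ (with $G$ acting trivially on $A$), and regard $I$ as a subset of $V$ via the inclusion. $H$ is a subextension of $G\rightthreetimes V$ with respect to the embedding $I\to V$ if there is an injective group homomorphism $\beta: H\to G\rightthreetimes V$ such that (i) for every $a\in A$, the image under $\beta$ of $\iota(a)$ is the element $a\omega_0\in V\leqslant G\rightthreetimes V$, and (ii) the composition of $\beta$ with the projection $G\rightthreetimes V\to G$ equals $\pi$. *)

(* Defs.v *)
From HB Require Import structures.
From mathcomp Require Import all_boot all_order all_algebra fingroup perm.
From mathcomp Require Import boolp classical_sets.

Set Implicit Arguments.
Unset Strict Implicit.
Unset Printing Implicit Defensive.

Import GRing.Theory.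

Local Open Scope group_scope.

(** MathComp permutations compose left to right, [permM : (s * t) x = t (s x)],
    so a morphism into [{perm Omega}] is a right action on [Omega]. *)

Section PermutationModule.
Variables (G : finGroupType) (Omega : finType) (A : comNzRingType).
Variable rho : {multiplicative G -> {perm Omega}}.

Definition St (w : Omega) : {set G} := [set g | rho g w == w].

Lemma rho1 : rho 1 = 1.
Proof. by apply: (mulgI (rho 1)); rewrite -gmulfM !mulg1. Qed.

Lemma St_group_set (w : Omega) : group_set (St w).
Proof.
apply/group_setP; split=> [|g h]; rewrite !inE ?rho1 ?perm1 //.
by move=> /eqP gw /eqP hw; rewrite gmulfM permM gw hw.
Qed.
Canonical St_group (w : Omega) := Group (St_group_set w).

(** [A^o] is [A] as a module over itself. *)
Definition permmod := {ffun Omega -> A^o}.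
HB.instance Definition _ := GRing.Lmodule.on permmod.

Definition basisv (w : Omega) : permmod := [ffun w' => (w' == w)%:R%R].

Definition mact (v : permmod) (g : G) : permmod :=
  (\sum_(w : Omega) (v w : A) *: basisv (rho g w))%R.

Definition omega0 : permmod := (\sum_(w : Omega) basisv w)%R.

(** The isomorphism of [A] with the submodule [I] generated by [omega0]
    (the AG-span of [omega0] is its A-span, [omega0] being fixed by [G]),
    followed by the inclusion of [I] into the permutation module. *)
Definition alpha (a : A) : permmod := (a *: omega0)%R.

Lemma mactE v g w : mact v g w = v ((rho g)^-1 w).
Proof.
rewrite /mact sum_ffunE (bigD1 ((rho g)^-1 w)) //= big1 => [|u neq_uw].
  by rewrite !ffunE permKV eqxx addr0 /GRing.scale /= mulr1.
rewrite !ffunE; case: eqP => [def_w|_]; last by rewrite scaler0.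
by rewrite def_w permK eqxx in neq_uw.
Qed.

Lemma mact_basisv w g : mact (basisv w) g = basisv (rho g w).
Proof.
apply/ffunP=> u; rewrite mactE !ffunE; congr (_ %:R)%R.
by rewrite (can2_eq (permKV _) (permK _)).
Qed.

Lemma omega0E w : omega0 w = 1%R.
Proof.
rewrite /omega0 sum_ffunE (bigD1 w) //= big1 => [|u neq_uw].
  by rewrite ffunE eqxx addr0.
by rewrite ffunE eq_sym (negPf neq_uw).
Qed.

Lemma mact_omega0 g : mact omega0 g = omega0.
Proof. by apply/ffunP=> w; rewrite mactE !omega0E. Qed.

Lemma mact1 v : mact v 1 = v.
Proof. by apply/ffunP=> w; rewrite mactE rho1 invg1 perm1. Qed.

Lemma mactM v g h : mact v (g * h) = mact (mact v g) h.
Proof. by apply/ffunP=> w; rewrite !mactE gmulfM invMg permM. Qed.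

Lemma mactD v1 v2 g : mact (v1 + v2)%R g = (mact v1 g + mact v2 g)%R.
Proof. by apply/ffunP=> w; rewrite !(ffunE, mactE). Qed.

Lemma mactN v g : mact (- v)%R g = (- mact v g)%R.
Proof. by apply/ffunP=> w; rewrite !(ffunE, mactE). Qed.

Lemma mact0 g : mact 0%R g = 0%R.
Proof. by apply/ffunP=> w; rewrite !(ffunE, mactE). Qed.

End PermutationModule.

Arguments omega0 {Omega A}.

Section SemidirectProduct.
Variables (G : finGroupType) (Omega : finType) (A : comNzRingType).
Variable rho : {multiplicative G -> {perm Omega}}.

(** The pair [(g, v)] stands for the element [gv]; the unused argument [rho]
    keys the group structure below, which is not the direct product one. *)
Definition semidirect (_ : {multiplicative G -> {perm Omega}}) :=
  (G * permmod Omega A)%type.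
Local Notation GV := (semidirect rho).

HB.instance Definition _ := Choice.on GV.

Definition sd_mul (x y : GV) : GV :=
  (x.1 * y.1, (mact rho x.2 y.1 + y.2)%R).
Definition sd_one : GV := (1, 0%R).
Definition sd_inv (x : GV) : GV := (x.1^-1, (- mact rho x.2 x.1^-1)%R).

Fact sd_mulA : associative sd_mul.
Proof.
move=> x y z; congr pair; first exact: mulgA.
by rewrite mactM mactD addrA.
Qed.

Fact sd_mul1 : left_id sd_one sd_mul.
Proof. by case=> g v; rewrite /sd_mul /= mul1g mact0 add0r. Qed.

Fact sd_mulr1 : right_id sd_one sd_mul.
Proof. by case=> g v; rewrite /sd_mul /= mulg1 mact1 addr0. Qed.

Fact sd_mulV : left_inverse sd_one sd_inv sd_mul.
Proof.
by case=> g v; rewrite /sd_mul /= mulVg mactN -mactM mulVg mact1 addNr.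
Qed.

Fact sd_mulgV : right_inverse sd_one sd_inv sd_mul.
Proof. by case=> g v; rewrite /sd_mul /= mulgV subrr. Qed.

HB.instance Definition _ :=
  isGroup.Build GV sd_mulA sd_mul1 sd_mulr1 sd_mulV sd_mulgV.

Definition sd_vec (v : permmod Omega A) : GV := (1, v).
Definition sd_proj (x : GV) : G := x.1.

End SemidirectProduct.

Section Extensions.
Variables (G : finGroupType) (A : comNzRingType) (H : groupType).
Variables (iota : A -> H) (pi : {multiplicative H -> G}).

Definition central_extension :=
  [/\ {morph iota : a b / (a + b)%R >-> a * b},
      injective iota,
      range iota = [set h | pi h = 1]%classic,
      range pi = [set: G]%classic
    & forall a h, commute (iota a) h].

Definition is_subgroup (K : set H) :=
  K 1 /\ forall x y, K x -> K y -> K (x / y).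

Definition is_complement (N P K : set H) :=
  [/\ is_subgroup K, (K `<=` P)%classic, (N `&` K = [set 1])%classic
    & [set n * k | n in N & k in K]%classic = P].

Definition splits_over (P N : set H) := exists K, is_complement N P K.

Definition liftable (S : {group G}) :=
  splits_over (pi @^-1` [set` S])%classic (range iota).

Definition subextension (Omega : finType)
    (rho : {multiplicative G -> {perm Omega}}) :=
  exists beta : {multiplicative H -> semidirect A rho},
    [/\ injective beta,
        forall a, beta (iota a) = sd_vec rho (alpha Omega a)
      & forall h, sd_proj (beta h) = pi h].

End Extensions.

(* Main.v *)
(* For [h] above [St w], the [w]-coordinate of the vector part of [beta h] is a
   group homomorphism into [A], and it maps [iota a] to [a]; its kernel is
   therefore a complement of the range of [iota]. *)
Require Import Defs.
From mathcomp Require Import all_boot all_order all_algebra fingroup perm.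
From mathcomp Require Import classical_sets.

Import GRing.Theory.
Local Open Scope group_scope.

Lemma mact_St (G : finGroupType) (Omega : finType) (A : comNzRingType)
    (rho : {multiplicative G -> {perm Omega}}) (v : permmod Omega A) g w :
  g \in St rho w -> mact rho v g w = v w.
Proof. by rewrite inE mactE => /eqP gw; rewrite -{1}gw permK. Qed.

Lemma alphaE (Omega : finType) (A : comNzRingType) (a : A) (w : Omega) :
  alpha Omega a w = a.
Proof. by rewrite /alpha ffunE omega0E /GRing.scale /= mulr1. Qed.

(** The vector part of [x * y] is [x.2] moved by [y.1], plus [y.2]. Only the right factor acts, so
    only [y.1] has to fix [w]. *)
Lemma sd_mul_coord (G : finGroupType) (Omega : finType) (A : comNzRingType)
    (rho : {multiplicative G -> {perm Omega}}) (x y : semidirect A rho) w :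
  y.1 \in St rho w -> (x * y).2 w = (x.2 w + y.2 w)%R.
Proof. by move=> yw; rewrite -(mact_St _ _ _ _ x.2 _ _ yw) ffunE. Qed.

Theorem theorem1 (G : finGroupType) (Omega : finType)
    (rho : {multiplicative G -> {perm Omega}})
    (p : nat) (A : comNzRingType) (pcharA : p \in [pchar A]%R)
    (H : groupType) (iota : A -> H) (pi : {multiplicative H -> G})
    (centext : central_extension iota pi)
    (subext : subextension iota pi rho) (w : Omega) :
  liftable iota pi (St_group rho w).
Proof.
have [iotaD _ ran_iota _ _] := centext.
have [beta [_ beta_iota beta_pi]] := subext.
pose f h : A := (beta h).2 w.
have fM x y : pi y \in St rho w -> f (x * y) = (f x + f y)%R.
  by rewrite -beta_pi /f gmulfM; apply: sd_mul_coord.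
have f_iota a : f (iota a) = a by rewrite /f beta_iota; apply: alphaE.
have pi_iota a : pi (iota a) = 1.
  have : range iota (iota a) by exists a.
  by rewrite ran_iota.
have iota0 : iota 0%R = 1 by apply: (mulgI (iota 0%R)); rewrite -iotaD addr0 mulg1.
have f1 : f 1 = 0%R by rewrite -iota0 f_iota.
have pi1 : pi 1 = 1 by rewrite -iota0 pi_iota.
exists [set h | pi h \in St rho w /\ f h = 0%R]%classic; split.
- split=> [|x y [xw fx] [yw fy]] /=; first by rewrite pi1 (group1 (St_group rho w)).
  have xyw : pi (x / y) \in St rho w.
    by rewrite -(groupMr (x := pi y) (G := St_group rho w)) // -gmulfM mulgVK.
  (* Additivity on [(x / y) * y = x] gives [f (x / y) + 0 = 0], with no formula for [f] on
     inverses. *)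
  split=> //; have := fM (x / y) y yw.
  by rewrite mulgVK fx fy addr0.
- by move=> h [].
- apply/seteqP; split=> h /=; last first.
    by move->; split; [exists 0%R | rewrite pi1 (group1 (St_group rho w))].
  (* On the range of [iota], [f] recovers the argument, so [f h = 0] forces [h = iota 0 = 1]. *)
  by case=> -[a _ <-] [_]; rewrite f_iota => ->.
- apply/seteqP; split=> h /=.
    by case=> _ [a _ <-] [k [kw _] <-]; rewrite gmulfM pi_iota mul1g.
  (* Splitting off [iota (f h)] leaves the factor [iota (- f h) * h], which still lies above
     [St rho w] and has [f]-value [- f h + f h = 0]. *)
  move=> hw; exists (iota (f h)); first by exists (f h).
  exists (iota (- f h)%R * h); last by rewrite mulgA -iotaD subrr iota0 mul1g.
  by rewrite gmulfM pi_iota mul1g fM // f_iota addNr.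
Qed.
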